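(* Let $T$ be a Bienaymé–Galton–Watson tree whose offspring distribution $L$ satisfies $\mathbb{E}[L]=m\ge1$ and $\mathbb{E}[L\log_+L]<\infty$. Then for any $\theta\in[0,1]$ with $\theta>1-\sqrt{1-\frac1m}$, \[\mathbb{P}(\text{there exists an infinite increasing path started from the root})>0.\] In particular, $\theta_c(m)\le1-\sqrt{1-\frac1m}$, where $1-\sqrt{1-\frac1m}\sim\frac1{2m}$ as $m\to\infty$.
   Context: Rough Mount Fuji labels: given a rooted tree with vertex set $V$, root $\rho$ and graph distance $d$, and $\theta\in[0,1]$, let $\{U_v:v\in V\}$ be i.i.d. Uniform$(0,1)$, independent of the tree, and set $X_v=U_v+\theta\,d(\rho,v)$. A simple path $\rho=v_0,v_1,\ldots$ is increasing if $X_{v_0}<X_{v_1}<\cdots$. A Bienaymé–Galton–Watson tree with offspring distribution $L$ (with values in $\{0,1,2,\ldots\}$) is the random rooted tree in which each vertex independently has a number of children distributed as $L$. Here $\log_+x=\max(\log x,0)$. For $\theta\in(0,1]$ let $m_c(\theta)$ be the smallest real root of $Q_\theta(m)=0$, where $Q_\theta(x)=\sum_{j=0}^{\lfloor1/\theta\rfloor+1}\frac{(-x)^j}{j!}(1-(j-1)\theta)^j$. The function $m_c$ is strictly decreasing with $m_c(1)=1$ and $m_c(\theta)\to\infty$ as $\theta\to0$, and for $m\ge1$ the critical value $\theta_c(m)$ is the unique $\theta\in(0,1]$ with $m_c(\theta)=m$. *)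

(* Defs.v *)
From HB Require Import structures.
From mathcomp Require Import all_boot all_order all_algebra.
From mathcomp Require Import all_classical all_reals all_analysis.

Set Implicit Arguments.
Unset Strict Implicit.
Unset Printing Implicit Defensive.

Import Order.TTheory GRing.Theory Num.Theory.
Import numFieldNormedType.Exports.

Local Open Scope classical_set_scope.
Local Open Scope ring_scope.

(* Lets the Landau notation f ~_(+oo_R) g find its filter structure. *)
Canonical pinfty_filterType (R : realType) : filter_on R :=
  FilterType (pinfty_nbhs R) _.

Definition log_plus (R : realType) (x : R) : R := Num.max (ln x) 0.

Definition mutually_independent (d : measure_display) (Omega : measurableType d)
    (R : realType) (P : probability Omega R) (I : eqType)
    (F : I -> set_system Omega) : Prop :=
  forall (s : seq I) (E : I -> set Omega),
    uniq s -> (forall i, i \in s -> F i (E i)) ->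
    P (\bigcap_(i in [set` s]) E i) = (\prod_(i <- s) P (E i))%E.

(* Ulam-Harris coding: a vertex is a finite word, the root is [::], and the
   children of v are rcons v 0, ..., rcons v (N v).-1. *)
Notation vertex := (seq nat).

Inductive in_tree (N : vertex -> nat) : vertex -> Prop :=
| in_tree_root : in_tree N [::]
| in_tree_child (v : vertex) (i : nat) :
    in_tree N v -> (i < N v)%N -> in_tree N (rcons v i).

Definition adjacent (u v : vertex) : Prop :=
  exists i, v = rcons u i \/ u = rcons v i.

(* The graph distance from the root to v is the length of the word v. *)
Definition rmf_label (R : realType) (theta : R) (U : vertex -> R) (v : vertex) : R :=
  U v + theta * (size v)%:R.

Definition infinite_increasing_path (R : realType) (N : vertex -> nat)
    (X : vertex -> R) (p : nat -> vertex) : Prop :=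
  [/\ p 0%N = [::],
      forall n, in_tree N (p n),
      forall n, adjacent (p n) (p n.+1),
      injective p
    & forall n, X (p n) < X (p n.+1)].

(* N v is the number of children of the vertex v (whenever v is in the tree)
   and U v is its label; all of them are jointly independent, so that the
   labels are independent of the tree. *)
Definition bgw_uniform_labels (d : measure_display) (Omega : measurableType d)
    (R : realType) (P : probability Omega R) (L : probability nat R)
    (N : vertex -> {RV P >-> nat}) (U : vertex -> {RV P >-> R}) : Prop :=
  [/\ forall v (A : set nat), distribution P (N v) A = L A,
      forall v (A : set R), measurable A ->
        distribution P (U v) A = uniform_prob (@ltr01 R) A
    & mutually_independent P (fun i : vertex + vertex =>
        match i with
        | inl v => preimage_set_system setT (N v) measurable
        | inr v => preimage_set_system setT (U v) measurable
        end)].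

Definition increasing_path_event (d : measure_display) (Omega : measurableType d)
    (R : realType) (P : probability Omega R) (theta : R)
    (N : vertex -> {RV P >-> nat}) (U : vertex -> {RV P >-> R}) : set Omega :=
  [set w | exists p, infinite_increasing_path (fun v => N v w)
                       (rmf_label theta (fun v => U v w)) p].

Definition Q_theta (R : realType) (theta x : R) : R :=
  \sum_(0 <= j < (Num.truncn theta^-1).+2)
    (- x) ^+ j / j`!%:R * (1 - (j%:R - 1) * theta) ^+ j.

Definition is_m_c (R : realType) (theta m : R) : Prop :=
  Q_theta theta m = 0 /\ forall x, Q_theta theta x = 0 -> m <= x.

(* Since m_c is injective on ]0, 1], at most one theta satisfies this; the
   relational form needs no default value where m_c is not known to exist. *)
Definition is_theta_c (R : realType) (m theta : R) : Prop :=
  0 < theta <= 1 /\ is_m_c theta m.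

(* Main.v *)
Require Import Defs.
From HB Require Import structures.
From mathcomp Require Import all_boot all_order all_algebra.
From mathcomp Require Import all_classical all_reals all_analysis.
From mathcomp Require Import measurable_realfun ring lra.

Set Implicit Arguments.
Unset Strict Implicit.
Unset Printing Implicit Defensive.

Import Order.TTheory GRing.Theory Num.Theory.
Import numFieldNormedType.Exports.

Local Open Scope classical_set_scope.
Local Open Scope ring_scope.

(** An increasing step from a vertex labelled u to a child labelled s is one
with s > u - theta, so the increasing paths from the root form a multitype
branching process whose mean operator is m K, where
  (K f)(u) = int_{max(u - theta, 0)}^1 f(s) ds   on [0, 1].
Everything rests on a positive f with K f >= (1 - (1 - theta)^2) f.  The
condition theta > 1 - sqrt(1 - 1/m) says exactly that
m (1 - (1 - theta)^2) > 1, so m K is then supercritical.  The function f is 1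
up to theta and affine beyond; [ramp_subeigen] is the inequality.  Applying it
to a threshold slightly below theta leaves room to replace [0, 1] by M cells
of equal length and to ask for increase only when the cells force it: this is
[discrete_subsolution], a positive vector v with a finite matrix inequality.

Positive probability.  Let q_n(b) be the probability that a vertex whose label
lies in cell b starts an increasing path through n further generations of cells.
If q_n >= e v, each child starts such a path with probability at least
p = e kappa v(b), and k children give at least k p - (k p)^2 by independence.
As p is of order e, a finite truncation of the mean of L still beats 1/kappa
for small e, and q_{n+1} >= e v follows ([prob_surv_ge]).  The bound is uniform
in n, and as every vertex has finitely many children, an infinite path exists as
soon as there are paths of every length ([infinite_path_reaches]).  The
independence of the subtrees hanging from different children comes from a
grouping theorem for mutually independent sigma-algebras, proved by the
pi-lambda argument ([sigma_over_independent]).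

The critical value.  The function e_x with e_x = 1 on [0, theta] and
e_x'(t) = - x e_x(t - theta) is a sum of truncated powers, and
e_x(1 + theta) = Q_theta(x).  Integrating its equation,
e_x = Q_theta(x) + x K e_x on [0, 1].  While Q_theta has no root in [0, x],
e_x stays positive ([dexp_ge0]), so e_x is a positive solution of x K g <= g.
The existence of a positive v with K v >= kappa v then forces x kappa <= 1:
compare at the point where v / e_x is largest.  Hence the smallest root m of
Q_theta satisfies m (1 - (1 - theta)^2) <= 1 ([critical_theta_le]). *)

(** * A subsolution of the mean operator *)

Section subsolution.
Variable R : realType.
Implicit Types t u x y k l : R.

Definition ramp k t u : R := 1 - Num.max (u - t) 0 / k.
Definition ramp_prim k t u : R := u - Num.max (u - t) 0 ^+ 2 / (2 * k).

(** The primitive of a nonincreasing function lies below its tangents.  With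
y - x = 1 / M this bounds an integral over a cell by the value at its left end,
so the sums below need no integral. *)
Lemma ramp_prim_concave k t x y : 0 < k ->
  ramp_prim k t y - ramp_prim k t x <= ramp k t x * (y - x).
Proof.
move=> k0; rewrite /ramp_prim /ramp.
set a := Num.max (x - t) 0; set b := Num.max (y - t) 0.
have H : 2 * a * (y - x) <= b ^+ 2 - a ^+ 2.
  have a0 : a >= 0 by rewrite le_max lexx orbT.
  have byt : b >= y - t by rewrite le_max lexx.
  have ab := sqr_ge0 (b - a).
  have [e|e] : a = 0 \/ a = x - t by rewrite /a; case: leP => _; [left|right].
    by rewrite e mulr0 mul0r expr0n subr0 sqr_ge0.
  have : 0 <= a * (b - (y - t)) by rewrite mulr_ge0 ?subr_ge0.
  by rewrite e in ab *; nra.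
rewrite -subr_ge0.
have -> : (1 - a / k) * (y - x) - (y - b ^+ 2 / (2 * k) - (x - a ^+ 2 / (2 * k)))
  = (b ^+ 2 - a ^+ 2 - 2 * a * (y - x)) / (2 * k) by field; lra.
by apply: divr_ge0; lra.
Qed.

(** The length over which the ramp decreases from 1 to 0.  For t <= 1/2 the
ramp vanishes at 1; for larger t it is the eigenvalue bound itself, and then
K f and (1 - (1 - t)^2) f decrease at the same rate. *)
Definition slope t : R := if t <= 2^-1 then 1 - t else 1 - (1 - t) ^+ 2.

Lemma slope_gt0 t : 0 < t < 1 -> 0 < slope t.
Proof. by move=> /andP[? ?]; rewrite /slope; case: ifP => _; nra. Qed.

Lemma ramp_gt0 t u : 0 < t < 1 -> u < 1 -> 0 < ramp (slope t) t u.
Proof.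
move=> t01 u1; have s0 := slope_gt0 t01; case/andP: t01 => t0 t1.
rewrite /ramp subr_gt0 ltr_pdivrMr// mul1r gt_max s0 andbT /slope.
have [t2|t2] := leP t 2^-1; first by lra.
have : 0 <= (t - 2^-1) * (1 - t) by apply: mulr_ge0; lra.
by nra.
Qed.

Lemma ramp_le1 t u : 0 < t < 1 -> ramp (slope t) t u <= 1.
Proof.
move=> /slope_gt0 s0; rewrite gerBl; apply: divr_ge0; last exact: ltW.
by rewrite le_max lexx orbT.
Qed.

(** The inequality K f >= (1 - (1 - t)^2) f for f = ramp (slope t) t.  The
right-hand side is the integral of f from max(u - t, 0) to 1.  In terms of
x = max(u - t, 0) both sides are piecewise quadratic, with a break at x = t. *)
Lemma ramp_subeigen t u : 0 < t < 1 -> u <= 1 ->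
  (1 - (1 - t) ^+ 2) * ramp (slope t) t u <=
  ramp_prim (slope t) t 1 - ramp_prim (slope t) t (Num.max (u - t) 0).
Proof.
move=> t01 u1; have s0 := slope_gt0 t01; case/andP: t01 => t0 t1.
rewrite /ramp /ramp_prim.
set x := Num.max (u - t) 0; set a := Num.max (x - t) 0.
have -> : Num.max (1 - t) 0 = 1 - t by apply/max_idPl; lra.
have x0 : 0 <= x by rewrite le_max lexx orbT.
have x1 : x <= 1 - t by rewrite ge_max; lra.
rewrite -subr_ge0; set k := slope t in s0 *.
have -> : 1 - (1 - t) ^+ 2 / (2 * k) - (x - a ^+ 2 / (2 * k)) -
    (1 - (1 - t) ^+ 2) * (1 - x / k) =
  (2 * k * (1 - x) - (1 - t) ^+ 2 + a ^+ 2 - 2 * (1 - (1 - t) ^+ 2) * (k - x))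
    / (2 * k) by field; lra.
apply: divr_ge0; last by lra.
have [[-> xt]|[-> xt]] : (a = 0 /\ x <= t) \/ (a = x - t /\ x >= t).
  have [xt|xt] := leP x t; [left|right; split; last exact: ltW].
    by split=> //; apply/max_idPr; lra.
  by apply/max_idPl; lra.
  rewrite /k /slope; have [tt|tt] := leP t 2^-1.
    (* The expression is affine in x on [0, t], so its sign is checked at the
       two ends: E0 is its value at 0 and E1, a cubic in t that is smallest
       near 1/3, its value at t. *)
    have E0 : 0 <= (1 - t) ^+ 2 * (1 - 2 * t).
      by apply: mulr_ge0; [exact: sqr_ge0|lra].
    have E1 : 0 <= (3^-1 - t) ^+ 2 * (25 / 3 - 4 * t) + 2 / 27.
      by rewrite addr_ge0//; apply: mulr_ge0; [exact: sqr_ge0|lra].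
    rewrite -(pmulr_rge0 _ t0).
    set E := (X in 0 <= X).
    have -> : E = (t - x) * ((1 - t) ^+ 2 * (1 - 2 * t)) +
        x * ((3^-1 - t) ^+ 2 * (25 / 3 - 4 * t) + 2 / 27) by rewrite /E; field.
    by apply: addr_ge0; apply: mulr_ge0 => //; lra.
  set E := (X in 0 <= X).
  have -> : E = (1 - t) ^+ 2 * (1 - 2 * (1 - t) ^+ 2) by rewrite /E; ring.
  by apply: mulr_ge0; [exact: sqr_ge0|nra].
rewrite /k /slope; have [tt|tt] := leP t 2^-1; last by lra.
set E := (X in 0 <= X).
have -> : E = (1 - 2 * t - x) ^+ 2 + 2 * t ^+2 * (1 - t - x).
  by rewrite /E; ring.
by rewrite addr_ge0 ?sqr_ge0// mulr_ge0 ?mulr_ge0 ?sqr_ge0//; lra.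
Qed.

(** The continuous inequality is used at a threshold t strictly between the
critical one and theta, and M is taken so large that 2 / M <= theta - t.  One
cell is lost because a label in cell i may be as large as (i + 1) / M, a second
one because the first admissible cell j starts up to 1 / M too late.  The
factor k m > 1 is the supercriticality. *)
Lemma discrete_subsolution m theta : 1 <= m -> 0 <= theta <= 1 ->
  1 - Num.sqrt (1 - m^-1) < theta ->
  exists (M : nat) (v : nat -> R) (k : R), [/\ (0 < M)%N, 1 < k * m,
    forall i, (i < M)%N -> 0 < v i <= 1 &
    forall i, (i < M)%N ->
      k * v i <= \sum_(0 <= j < M | i.+1%:R <= j%:R + theta * M%:R) v j / M%:R].
Proof.
move=> m1 /andP[th0 th1]; set a := 1 - _ => ath.
have m0 : 0 < m by lra.
have im : 0 < m^-1 <= 1 by rewrite invr_gt0 m0 invf_le1.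
have a0 : 0 <= a.
  by rewrite subr_ge0 -[leRHS]sqrtr1 ler_sqrt; lra.
have a1 : a <= 1 by rewrite gerBl sqrtr_ge0.
pose t := (a + theta) / 2.
have t01 : 0 < t < 1 by rewrite /t; lra.
have s0 := slope_gt0 t01.
have k1 : 1 < (1 - (1 - t) ^+ 2) * m.
  have : (1 - t) ^+ 2 < (1 - a) ^+ 2 by rewrite ltr_pXn2r ?nnegrE//; rewrite /t; lra.
  rewrite /a subKr sqr_sqrtr; last by lra.
  by rewrite -ltr_pdivrMr// div1r; lra.
have [M M0 tM] : exists2 M : nat, (0 < M)%N & 2 / M%:R <= theta - t.
  have d0 : 0 < theta - t by rewrite /t; lra.
  exists (Num.truncn (2 / (theta - t))).+1 => //.
  rewrite ler_pdivrMr ?ltr0n// mulrC -ler_pdivrMr//.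
  by apply/ltW/truncnS_gt.
have MR0 : 0 < M%:R :> R by rewrite ltr0n.
exists M, (fun i => ramp (slope t) t (i%:R / M%:R)), (1 - (1 - t) ^+ 2).
have frac_lt1 i : (i < M)%N -> (i%:R / M%:R : R) < 1.
  by move=> iM; rewrite ltr_pdivrMr// mul1r ltr_nat.
split=> // [i iM|i iM].
  by rewrite ramp_gt0 ?ramp_le1 ?frac_lt1.
set u : R := i%:R / M%:R; set F := ramp_prim (slope t) t.
have F_nd x y : x <= y -> y < 1 -> F x <= F y.
  move=> xy y1; rewrite -subr_le0 (le_trans (ramp_prim_concave _ _ _ s0))//.
  by rewrite mulr_ge0_le0 ?subr_le0// ltW// ramp_gt0.
set x := Num.max (u - t) 0.
(* The partial sums dominate the telescoping sum of F; the cells skipped by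
   the condition lie to the left of x, where F only increases up to F x. *)
suff H n : (n <= M)%N -> F (n%:R / M%:R) - F x <=
    \sum_(0 <= j < n | i.+1%:R <= j%:R + theta * M%:R)
      ramp (slope t) t (j%:R / M%:R) / M%:R.
  apply: (le_trans _ (H M _)) => //; rewrite divff ?gt_eqF//.
  by apply: ramp_subeigen => //; exact/ltW/frac_lt1.
have x1 : x < 1 by rewrite gt_max ltr01 andbT; have := frac_lt1 _ iM; rewrite /u; lra.
elim: n => [|n IH] nM.
  by rewrite big_nil mul0r subr_le0 F_nd// le_max lexx orbT.
rewrite big_mkcond big_nat_recr//= -big_mkcond/=.
have [nx|nx] := leP (n.+1%:R / M%:R) x.
  apply: (@le_trans _ _ 0); first by rewrite subr_le0 F_nd.
  apply: addr_ge0.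
    rewrite big_nat_cond; apply: sumr_ge0 => j /andP[/andP[_ jn] _].
    by rewrite divr_ge0// ltW// ramp_gt0// frac_lt1// (ltn_trans jn).
  by case: ifP => // _; rewrite divr_ge0// ltW// ramp_gt0// frac_lt1.
have -> : i.+1%:R <= n%:R + theta * M%:R.
  have : u - t < n.+1%:R / M%:R by rewrite (le_lt_trans _ nx)// le_max lexx.
  rewrite ltr_pdivlMr// mulrBl /u divfK ?gt_eqF// -(ltrD2r (t * M%:R)) subrK.
  have : 2 <= (theta - t) * M%:R by rewrite -ler_pdivrMr.
  by rewrite -!natr1; lra.
have := ramp_prim_concave t (n%:R / M%:R) (n.+1%:R / M%:R) s0.
have -> : n.+1%:R / M%:R - n%:R / M%:R = M%:R^-1 :> R.
  by rewrite -mulrBl -natrB// subSnn mul1r.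
by have := IH (ltnW nM); rewrite -/F; lra.
Qed.

End subsolution.

(** * Grouping independent sigma-algebras *)

Lemma sigma_algebra_setI (T : Type) (G : set_system T) :
  sigma_algebra setT G -> setI_closed G.
Proof. by move=> /(sigma_algebraP (fun X _ => @subsetT _ X))[]. Qed.

Section independence.
Context d (Omega : measurableType d) (R : realType) (P : probability Omega R).
Implicit Types A B : set Omega.

(** Independence of B is stable under complements and disjoint unions, but not
under intersections: this is what makes the pi-lambda theorem necessary. *)
Lemma dynkin_independent B : measurable B ->
  dynkin [set A | measurable A /\ P (A `&` B) = (P A * P B)%E].
Proof.
move=> mB; split.
- by split; [exact: measurableT|rewrite setTI probability_setT mul1e].
- move=> A [mA AB]; split; first exact: measurableC.
  have AC : P B = (P (B `\` A) + P (A `&` B))%E by rewrite setIC -measureDI.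
  rewrite setIC -setDE probability_setC// muleBl ?fin_num_measure// mul1e -AB.
    by rewrite AC addeK// fin_num_measure//; exact: measurableI.
- move=> F tF GF; have mF n : measurable (F n) by have [] := GF n.
  split; first exact: bigcup_measurable.
  rewrite setI_bigcupl measure_bigcup//.
    rewrite measure_bigcup//.
    rewrite -(fineK (fin_num_measure P B mB)) muleC -nneseriesZl//.
    apply: eq_eseriesr => n _; rewrite fineK ?fin_num_measure// muleC.
    by have [_] := GF n.
  - by move=> n _; exact: measurableI.
  - by apply/trivIset_setIr.
Qed.

Lemma independent_sigma (G : set_system Omega) B :
  setI_closed G -> (forall A, G A -> measurable A) -> measurable B ->
  (forall A, G A -> P (A `&` B) = (P A * P B)%E) ->
  forall A, <<s G >> A -> measurable A /\ P (A `&` B) = (P A * P B)%E.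
Proof.
move=> GI mG mB GB A; rewrite -setI_closed_g_dynkin_g_sigma_algebra//.
move: A; apply: smallest_sub; first exact: dynkin_independent.
by move=> A GA; split; [exact: mG|exact: GB].
Qed.

Section grouping.
Variables (I : eqType) (F : I -> set_system Omega).
Hypothesis F_sigma : forall i, sigma_algebra setT (F i).
Hypothesis F_meas : forall i, F i `<=` measurable.
Hypothesis F_indep : mutually_independent P F.

(** The finite intersections of generating events form a pi-system on which the
product rule is the hypothesis of mutual independence. *)
Definition cylinders (J : set I) : set_system Omega :=
  [set A | exists (s : seq I) (E : I -> set Omega),
    [/\ uniq s, forall i, i \in s -> J i, forall i, i \in s -> F i (E i) &
        A = \bigcap_(i in [set` s]) E i]].

Definition sigma_over (J : set I) : set_system Omega :=
  <<s \bigcup_(i in J) F i >>.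

Let FT i : F i setT.
Proof.
by have [F0 FC _] := F_sigma i; rewrite -(setD0 setT); exact: FC.
Qed.

Let FI i A B : F i A -> F i B -> F i (A `&` B).
Proof. exact: (sigma_algebra_setI (F_sigma i)). Qed.

Lemma cylinders_setI J : setI_closed (cylinders J).
Proof.
move=> _ _ [s [E [us sJ sF ->]]] [s' [E' [us' sJ' sF' ->]]].
(* Padding with the whole space outside the index lists lets the two
   intersections run over the same indices. *)
pose X (r : seq I) (D : I -> set Omega) i := if i \in r then D i else setT.
exists (undup (s ++ s')), (fun i => X s E i `&` X s' E' i); split.
- exact: undup_uniq.
- by move=> i; rewrite mem_undup mem_cat => /orP[/sJ|/sJ'].
- move=> i _; apply: FI; rewrite /X; case: ifP => // ?; [exact: sF|exact: sF'].
- apply/seteqP; split => w.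
    move=> [H H'] i /= _; split; rewrite /X; case: ifP => // iS; [exact: H|exact: H'].
  move=> H; split => i /= iS; have := H i; rewrite /= mem_undup mem_cat iS ?orbT.
    by move=> /(_ isT) []; rewrite /X iS.
  by move=> /(_ isT) []; rewrite /X iS.
Qed.

Lemma sub_cylinders J : \bigcup_(i in J) F i `<=` cylinders J.
Proof.
move=> A [i Ji FA]; exists [:: i], (fun=> A); split => //.
- by move=> j; rewrite inE => /eqP ->.
- by move=> j; rewrite inE => /eqP ->.
- apply/seteqP; split => w; first by move=> wA j.
  by apply; rewrite /= inE.
Qed.

Lemma cylinders_measurable J : cylinders J `<=` measurable.
Proof.
move=> _ [s [E [us sJ sF ->]]].
apply: fin_bigcap_measurable => // i /= /sF; exact: F_meas.
Qed.

Lemma cylinders_independent J K A B : J `&` K `<=` set0 ->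
  cylinders J A -> cylinders K B -> P (A `&` B) = (P A * P B)%E.
Proof.
move=> JK [s [E [us sJ sF ->]]] [s' [E' [us' sJ' sF' ->]]].
pose D i := if i \in s then E i else E' i.
have sD i : i \in s -> D i = E i by rewrite /D => ->.
have ss' i : i \in s' -> i \notin s.
  by move=> is'; apply/negP => iS; apply: (JK i); split; [exact: sJ|exact: sJ'].
have s'D i : i \in s' -> D i = E' i by move=> /ss'; rewrite /D => /negbTE ->.
have -> : \bigcap_(i in [set` s]) E i `&` \bigcap_(i in [set` s']) E' i =
    \bigcap_(i in [set` s ++ s']) D i.
  apply/seteqP; split => w.
    move=> [H H'] i /=; rewrite mem_cat /D; case: ifPn => [iS _|_ /= iS]; first exact: H.
    exact: H'.
  move=> H; split => i /= iS; have := H i; rewrite /= mem_cat iS ?orbT.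
    by move=> /(_ isT); rewrite sD.
  by move=> /(_ isT); rewrite s'D.
rewrite (F_indep us sF) (F_indep us' sF') F_indep ?big_cat/=.
- by congr (_ * _)%E; apply: eq_big_seq => i; [move/sD ->|move/s'D ->].
- rewrite cat_uniq us us' andbT/=; apply/hasPn => i; exact: ss'.
- by move=> i; rewrite mem_cat => /orP[iS|iS]; [rewrite sD|rewrite s'D]; auto.
Qed.

Lemma sigma_over_cylinders J : sigma_over J `<=` <<s cylinders J >>.
Proof. by apply: sub_sigma_algebra2; exact: sub_cylinders. Qed.

Lemma sigma_over_measurable J : sigma_over J `<=` measurable.
Proof.
apply: smallest_sub; first exact: sigma_algebra_measurable.
by move=> A [i _]; exact: F_meas.
Qed.

(** The pi-lambda theorem is applied twice, first to pass from cylinders over J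
to the whole sigma-algebra against a fixed cylinder over K, then over K against
a fixed event of the first sigma-algebra. *)
Lemma sigma_over_independent J K A B : J `&` K `<=` set0 ->
  sigma_over J A -> sigma_over K B -> P (A `&` B) = (P A * P B)%E.
Proof.
move=> JK JA KB.
have mA := sigma_over_measurable JA.
have half C : cylinders K C -> P (C `&` A) = (P C * P A)%E.
  move=> KC; rewrite setIC muleC.
  have mC := cylinders_measurable KC.
  by have [] := independent_sigma (@cylinders_setI J) (@cylinders_measurable J) mC
    (fun D JD => cylinders_independent JK JD KC) (sigma_over_cylinders JA).
rewrite setIC muleC.
by have [] := independent_sigma (@cylinders_setI K) (@cylinders_measurable K) mA
  half (sigma_over_cylinders KB).
Qed.

Lemma sigma_over_sub J K : J `<=` K -> sigma_over J `<=` sigma_over K.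
Proof. by move=> JK; apply: sub_sigma_algebra2; exact: bigcup_subset. Qed.

Lemma sigma_over_gen J i A : J i -> F i A -> sigma_over J A.
Proof. by move=> Ji FA; apply: sub_sigma_algebra; exists i. Qed.

Lemma sigma_over_bigcup J (A : nat -> set Omega) :
  (forall n, sigma_over J (A n)) -> sigma_over J (\bigcup_n A n).
Proof. exact: sigma_algebra_bigcup. Qed.

Lemma sigma_over_setI J A B : sigma_over J A -> sigma_over J B ->
  sigma_over J (A `&` B).
Proof. exact: (sigma_algebra_setI (smallest_sigma_algebra _ _)). Qed.

End grouping.
End independence.

(** * Real-valued probabilities and the offspring law *)

Section real_probability.
Context d (Omega : measurableType d) (R : realType) (P : probability Omega R).
Implicit Types A B : set Omega.

Lemma fine_prob_le A B : measurable A -> measurable B -> A `<=` B ->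
  fine (P A) <= fine (P B).
Proof.
by move=> mA mB AB; rewrite fine_le ?fin_num_measure// le_measure ?inE.
Qed.

Lemma fine_probC A : measurable A -> fine (P (~` A)) = 1 - fine (P A).
Proof. by move=> mA; rewrite probability_setC// fineB ?fin_num_measure. Qed.

Lemma fine_prob_sum_le (X : nat -> set Omega) (Q : pred nat) n S :
  measurable S -> (forall k, measurable (X k)) -> trivIset setT X ->
  (forall k, (k < n)%N -> Q k -> X k `<=` S) ->
  \sum_(0 <= k < n | Q k) fine (P (X k)) <= fine (P S).
Proof.
move=> mS mX tX XS.
pose Y k := if Q k then X k else set0.
have mY k : measurable (Y k) by rewrite /Y; case: ifP.
have tY : trivIset setT Y.
  apply/trivIsetP => i j _ _ ij; rewrite /Y; case: ifP => _; last by rewrite set0I.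
  case: ifP => _; last by rewrite setI0.
  by move/trivIsetP : tX; apply.
have -> : \sum_(0 <= k < n | Q k) fine (P (X k)) =
    fine (P (\big[setU/set0]_(k < n) Y k)).
  rewrite measure_bigsetU// big_mkord -sum_fine; last first.
    by move=> i _; rewrite fin_num_measure.
  rewrite big_mkcond; apply: eq_bigr => i _; rewrite /Y; case: ifP => //.
  by rewrite measure0.
apply: fine_prob_le => //; first exact: bigsetU_measurable.
rewrite -bigcup_mkord => w [k /= kn]; rewrite /Y; case: ifP => // Qk; exact: XS.
Qed.

End real_probability.

Lemma uniform_prob_bin (R : realType) (M b : nat) : (b < M)%N ->
  fine (uniform_prob (@ltr01 R) `[b%:R / M%:R, b.+1%:R / M%:R[) = M%:R^-1.
Proof.
move=> bM; have M0 : (0 : R) < M%:R by rewrite ltr0n (leq_ltn_trans _ bM).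
have b0 : 0 <= b%:R / M%:R :> R by rewrite divr_ge0.
have bb : b%:R / M%:R < b.+1%:R / M%:R :> R by rewrite ltr_pM2r ?invr_gt0// ltr_nat.
have b1 : b.+1%:R / M%:R <= 1 :> R by rewrite ler_pdivrMr// mul1r ler_nat.
rewrite /uniform_prob integral_uniform_pdf setIidl; last first.
  move=> x; rewrite /= !in_itv/= => /andP[bx xb].
  by rewrite (le_trans b0 bx) (le_trans (ltW xb) b1).
rewrite (eq_integral (fun=> 1%E)); last first.
  move=> x; rewrite inE/= in_itv/= => /andP[bx xb].
  rewrite /uniform_pdf (le_trans b0 bx) (le_trans (ltW xb) b1).
  by rewrite subr0 invr1.
rewrite integral_cst//= mul1e lebesgue_measure_itv/= lte_fin bb/=.
by rewrite -mulrBl -natrB// subSnn mul1r.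
Qed.

(** A weak form of the second Bonferroni inequality, for the union of k
independent events of probability p. *)
Lemma one_minus_expn_ge (R : realType) (p : R) (k : nat) : 0 <= p <= 1 ->
  k%:R * p - k%:R ^+ 2 * p ^+ 2 <= 1 - (1 - p) ^+ k.
Proof.
move=> /andP[p0 p1]; elim: k => [|k IH]; first by rewrite expr0n/= !mul0r !subrr.
rewrite [(1 - p) ^+ _]exprS -natr1.
have k0 : 0 <= (k%:R : R) by [].
have H : (1 - p) * (1 - p) ^+ k <= (1 - p) * (1 - (k%:R * p - k%:R ^+ 2 * p ^+ 2)).
  by apply: ler_wpM2l; lra.
have : 0 <= k%:R ^+ 2 * p ^+ 3 by rewrite mulr_ge0 ?exprn_ge0.
have : 0 <= k%:R * p ^+ 2 by rewrite mulr_ge0 ?exprn_ge0.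
have : 0 <= p ^+ 2 by rewrite exprn_ge0.
by move: H; set y := (1 - p) * _; nra.
Qed.

(** Truncating the offspring law costs arbitrarily little of its mean; after
truncation the quadratic loss k^2 p^2 has a finite mean. *)
Lemma expectation_partial_sum (R : realType) (L : probability nat R) (m c : R) :
  'E_L[fun k : nat => k%:R]%E = m%:E -> c < m ->
  exists B : nat, c < \sum_(0 <= k < B) k%:R * fine (L [set k]).
Proof.
move=> Em cm; apply/not_existsP => H.
have Hle B : \sum_(0 <= k < B) k%:R * fine (L [set k]) <= c.
  by rewrite leNgt; exact/negP/H.
have : (m%:E <= c%:E)%E; last by rewrite lee_fin leNgt cm.
rewrite -Em unlock.
rewrite (_ : setT = \bigcup_k [set k]); last first.
  by apply/seteqP; split => k // _; exists k.
rewrite ge0_integral_bigcup//.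
- rewrite (eq_eseriesr (g := fun k => (k%:R * fine (L [set k]))%:E)); last first.
    move=> k _; rewrite (eq_integral (fun=> (k%:R)%:E)); last first.
      by move=> x; rewrite inE => ->.
    by rewrite integral_cst// EFinM fineK ?fin_num_measure.
  apply: lime_le.
    by apply: is_cvg_nneseries => k _ _; rewrite lee_fin mulr_ge0 ?fine_ge0.
  by apply: nearW => B; rewrite sumEFin lee_fin.
- by move=> i j _ _ [x [/= xi xj]]; rewrite -xi -xj.
Qed.

(** * Infinite increasing paths and paths of every length *)

Section increasing_paths.
Variables (R : realType) (N : vertex -> nat) (X : vertex -> R).

Fixpoint reaches (n : nat) (v : vertex) : Prop :=
  if n is n'.+1 then
    exists i, [/\ (i < N v)%N, X v < X (rcons v i) & reaches n' (rcons v i)]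
  else True.

Lemma reachesS n v : reaches n.+1 v -> reaches n v.
Proof.
elim: n v => [//|n IH] v [i [iN Xi r]]; exists i; split => //; exact: IH.
Qed.

Lemma reaches_le n n' v : (n <= n')%N -> reaches n' v -> reaches n v.
Proof.
move=> /subnK <-; elim: (n' - n)%N => [//|k IH]; rewrite addSn => /reachesS; exact: IH.
Qed.

(** The step of Koenig's lemma: among the finitely many children, some child
must start paths of every length, for otherwise a length exceeding all the
failing ones would be unreachable from v. *)
Lemma reaches_child v : (forall n, reaches n v) -> exists i,
  [/\ (i < N v)%N, X v < X (rcons v i) & forall n, reaches n (rcons v i)].
Proof.
move=> rv; apply: contrapT => noi.
have /choice[f fP] i : exists n, (i < N v)%N -> X v < X (rcons v i) ->
    ~ reaches n (rcons v i).
  have [[iN Xi]|H] := pselect ((i < N v)%N /\ X v < X (rcons v i)); last first.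
    by exists 0%N => iN Xi; case: H.
  apply: contrapT => /forallNP H; apply: noi; exists i; split => // n.
  by apply: contrapT => Hn; apply: (H n).
have [i [iN Xi ri]] := rv (\max_(i < N v) f i).+1.
apply: (fP i iN Xi); apply: reaches_le ri.
exact: (leq_bigmax (Ordinal iN)).
Qed.

Lemma in_tree_rcons v i : in_tree N (rcons v i) -> (i < N v)%N.
Proof.
move: {-1}(rcons v i) (erefl (rcons v i)) => w + tw.
case: tw => [|u j _ jN]; first by case: v.
by move=> /rcons_inj[-> ->].
Qed.

(** A simple path from the root never steps back: the parent of the current
vertex is its predecessor on the path, by induction. *)
Lemma increasing_path_child p : infinite_increasing_path N X p ->
  forall n, exists i, p n.+1 = rcons (p n) i.
Proof.
move=> [p0 pT pA pI _]; elim=> [|n [j IH]].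
  by have [i [->|]] := pA 0%N; [exists i|rewrite p0; case: (p 1%N)].
have [i [->|]] := pA n.+1; first by exists i.
by rewrite IH => /rcons_inj[/pI /eqP + _]; rewrite -[X in X == _]addn0 -addn2 eqn_add2l.
Qed.

Lemma infinite_path_reaches :
  (exists p, infinite_increasing_path N X p) <-> (forall n, reaches n [::]).
Proof.
split=> [[p pP] n|rn].
  have pC := increasing_path_child pP; case: pP => [p0 pT _ _ pX].
  rewrite -p0; elim: n 0%N => [//|n IH] k.
  have [i ki] := pC k; exists i; rewrite -ki; split => //.
  by apply: in_tree_rcons; rewrite -ki.
have /choice[f fP] v : exists i, (forall n, reaches n v) ->
    [/\ (i < N v)%N, X v < X (rcons v i) & forall n, reaches n (rcons v i)].
  have [rv|nrv] := pselect (forall n, reaches n v); last by exists 0%N => /nrv.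
  by have [i Hi] := reaches_child rv; exists i.
pose p n := iter n (fun v => rcons v (f v)) [::].
have rp n : forall k, reaches k (p n).
  by elim: n => [//|n IH]; have [] := fP _ IH.
have sp n : size (p n) = n by elim: n => //= n IH; rewrite size_rcons IH.
exists p; split => //.
- elim=> [|n IH]; first exact: in_tree_root.
  by apply: in_tree_child => //; have [] := fP _ (rp n).
- by move=> n; exists (f (p n)); left.
- by move=> i j pij; rewrite -(sp i) pij sp.
- by move=> n; have [] := fP _ (rp n).
Qed.

End increasing_paths.

Section measurability.
Context d (Omega : measurableType d) (R : realType) (P : probability Omega R).
Variables (theta : R) (N : vertex -> {RV P >-> nat}) (U : vertex -> {RV P >-> R}).

Definition reach_event (n : nat) (v : vertex) : set Omega :=
  [set w | reaches (fun v => N v w) (rmf_label theta (fun v => U v w)) n v].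

Lemma increasing_path_eventE :
  increasing_path_event theta N U = \bigcap_n reach_event n [::].
Proof.
apply/seteqP; split => w.
  by move=> /infinite_path_reaches H n _; exact: H.
by move=> H; apply/infinite_path_reaches => n; exact: H.
Qed.

Lemma measurable_preimageN v (A : set nat) : measurable (N v @^-1` A).
Proof. by rewrite -[_ @^-1` _]setTI; exact: measurable_funP. Qed.

Lemma measurable_preimageU v (A : set R) : measurable A -> measurable (U v @^-1` A).
Proof. by move=> mA; rewrite -[_ @^-1` _]setTI; exact: measurable_funP. Qed.

Lemma measurable_reach_event n v : measurable (reach_event n v).
Proof.
elim: n v => [|n IH] v.
  by rewrite (_ : reach_event _ _ = setT)//; apply/seteqP; split.
rewrite (_ : reach_event _ _ = \bigcup_i (N v @^-1` [set k | (i < k)%N] `&`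
    [set w | U v w + theta * (size v)%:R <
             U (rcons v i) w + theta * (size (rcons v i))%:R] `&`
    reach_event n (rcons v i))).
  apply: bigcup_measurable => i _; apply: measurableI => //; apply: measurableI.
    exact: measurable_preimageN.
  have mX u : measurable_fun setT (fun w => U u w + theta * (size u)%:R).
    by apply: (@measurable_funD _ _ _ setT (U u) (cst _)) => //; exact: measurable_cst.
  have mtrue : measurable [set true] by [].
  have := measurable_fun_ltr (mX v) (mX (rcons v i)) measurableT mtrue.
  by rewrite setTI.
apply/seteqP; split => w.
  by move=> [i [iN Xi r]]; exists i.
by move=> [i _ [[/= iN Xi] r]]; exists i; split.
Qed.

Lemma measurable_increasing_path : measurable (increasing_path_event theta N U).
Proof.
rewrite increasing_path_eventE; apply: bigcapT_measurable => n.
exact: measurable_reach_event.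
Qed.

(** Continuity from above, as the events of reaching generation n decrease. *)
Lemma increasing_path_prob_ge (c : R) :
  (forall n, (c%:E <= P (reach_event n [::]))%E) ->
  (c%:E <= P (increasing_path_event theta N U))%E.
Proof.
move=> cP; have mE := measurable_increasing_path.
rewrite increasing_path_eventE in mE *.
have H : P \o (fun n => reach_event n [::]) @ \oo --> P (\bigcap_n reach_event n [::]).
  apply: nonincreasing_cvg_mu => //.
  - by rewrite (le_lt_trans (probability_le1 _ _)) ?ltry//; exact: measurable_reach_event.
  - by move=> n; exact: measurable_reach_event.
  - by move=> n n' nn'; apply/subsetPset => w; exact: reaches_le.
rewrite -(cvg_lim _ H)//; apply: lime_ge; first exact: cvgP H.
exact: nearW.
Qed.

End measurability.

(** * Survival of the discretized branching process *)

Section survival.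
Context d (Omega : measurableType d) (R : realType) (P : probability Omega R).
Variables (L : probability nat R).
Variables (N : vertex -> {RV P >-> nat}) (U : vertex -> {RV P >-> R}).
Hypothesis NU : bgw_uniform_labels L N U.
Variables (theta : R) (M : nat).
Hypothesis M_gt0 : (0 < M)%N.

Let F (i : vertex + vertex) : set_system Omega :=
  match i with
  | inl v => preimage_set_system setT (N v) measurable
  | inr v => preimage_set_system setT (U v) measurable
  end.

Let F_sigma i : sigma_algebra setT (F i).
Proof.
by case: i => v; apply: sigma_algebra_preimage; exact: sigma_algebra_measurable.
Qed.

Let F_meas i : F i `<=` measurable.
Proof.
case: i => v A [B mB <-]; rewrite setTI.
  exact: measurable_preimageN.
exact: measurable_preimageU.
Qed.

Let F_indep : mutually_independent P F. Proof. by case: NU. Qed.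

Let indep := sigma_over_independent F_sigma F_meas F_indep.
Let sigma_meas J : sigma_over F J `<=` measurable.
Proof. exact: sigma_over_measurable. Qed.

Definition bin (b : nat) : set R := `[b%:R / M%:R, b.+1%:R / M%:R[%classic.

(** The discrete condition on cells forces an increasing step whatever the
position of the labels inside their cells. *)
Lemma bin_step b b' x y : bin b x -> bin b' y ->
  b.+1%:R <= b'%:R + theta * M%:R -> x < y + theta.
Proof.
have M0 : 0 < M%:R :> R by rewrite ltr0n.
rewrite /bin/= !in_itv/= => /andP[_ xb] /andP[by_ _] bb.
apply: (lt_le_trans xb); rewrite -(lerD2r theta) in by_.
apply: le_trans by_; rewrite ler_pdivrMr// mulrDl divfK// gt_eqF//.
Qed.

Lemma bin_disjoint b b' x : bin b x -> bin b' x -> b = b'.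
Proof.
have M0 : 0 < M%:R :> R by rewrite ltr0n.
rewrite /bin/= !in_itv/= => /andP[bx xb] /andP[bx' xb'].
have := le_lt_trans bx xb'; have := le_lt_trans bx' xb.
rewrite !ltr_pM2r ?invr_gt0// !ltr_nat !ltnS => h1 h2.
by apply/eqP; rewrite eqn_leq h1 h2.
Qed.

(** Given events S w c, read as: the vertex w, if its label lies in cell c,
starts a long enough path, this is the event that the child number j of v
continues a path from v, the label of v being assumed to lie in cell b. *)
Definition branch (S : vertex -> nat -> set Omega) v b j : set Omega :=
  \bigcup_(b' in [set b' | (b' < M)%N /\ b.+1%:R <= b'%:R + theta * M%:R])
    (U (rcons v j) @^-1` bin b' `&` S (rcons v j) b').

(** The cell b of v is a parameter and not read from the label of v: the event
is then independent of U v, and no conditioning on a label is ever needed. *)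
Fixpoint surv (n : nat) (v : vertex) (b : nat) : set Omega :=
  if n is n'.+1 then
    \bigcup_k (N v @^-1` [set k] `&` \bigcup_(j in `I_k) branch (surv n') v b j)
  else setT.

Definition below (v : vertex) : set (vertex + vertex) :=
  [set i | match i with inl w => prefix v w | inr w => prefix v w end].

(** The variables that decide which paths start at v once its cell is given. *)
Definition strictly_below (v : vertex) : set (vertex + vertex) :=
  [set i | match i with inl w => prefix v w | inr w => prefix v w && (w != v) end].

Lemma surv_reach n v b : U v @^-1` bin b `&` surv n v b `<=` reach_event theta N U n v.
Proof.
elim: n v b => [//|n IH] v b w [Ub [k _ [/= Nk [j /= jk [b' [b'M bb'] [Ub' sb']]]]]].
exists j; split; first by rewrite Nk.
  by have := bin_step Ub Ub' bb'; rewrite /rmf_label size_rcons -natr1; lra.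
by apply: (IH _ b').
Qed.

Lemma prefix_rcons_inj (v w : vertex) i j :
  prefix (rcons v i) w -> prefix (rcons v j) w -> i = j.
Proof.
by rewrite !prefixE !size_rcons => /eqP -> /eqP /rcons_inj[].
Qed.

Lemma prefix_rcons_self (v : vertex) j : prefix (rcons v j) v = false.
Proof.
apply/negP => /prefixP[s /(congr1 size)/eqP].
by rewrite size_cat size_rcons addSnnS -[X in X == _]addn0 eqn_add2l.
Qed.

Lemma below_rcons v j : below (rcons v j) `<=` strictly_below v.
Proof.
have vj w : prefix (rcons v j) w -> prefix v w && (w != v).
  move=> jw; rewrite (prefix_trans (prefix_rcons _ _) jw).
  by apply/eqP => wv; rewrite wv prefix_rcons_self in jw.
by move=> [w|w] /= /vj // /andP[].
Qed.

Lemma branch_sigma n v b j :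
  (forall b', sigma_over F (strictly_below (rcons v j)) (surv n (rcons v j) b')) ->
  sigma_over F (below (rcons v j)) (branch (surv n) v b j).
Proof.
move=> sS; rewrite /branch bigcup_mkcond; apply: sigma_over_bigcup => b'.
case: ifP => _; last exact: sigma_algebra0.
apply: sigma_over_setI.
  apply: (@sigma_over_gen _ _ _ _ _ (inr (rcons v j))); first exact: prefix_refl.
  by exists (bin b'); rewrite ?setTI//; exact: measurable_itv.
by apply: sigma_over_sub (sS b') => -[w|w] //= /andP[].
Qed.

Lemma surv_sigma n v b : sigma_over F (strictly_below v) (surv n v b).
Proof.
elim: n v b => [|n IH] v b.
  by rewrite /= -setC0; apply: sigma_algebraC; exact: sigma_algebra0.
apply: sigma_over_bigcup => k; apply: sigma_over_setI.
  apply: (@sigma_over_gen _ _ _ _ _ (inl v)); first exact: prefix_refl.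
  by exists [set k]; rewrite ?setTI.
rewrite bigcup_mkcond; apply: sigma_over_bigcup => j.
case: ifP => _; last exact: sigma_algebra0.
apply: sigma_over_sub (@branch_sigma n v b j _) => // ; exact: below_rcons.
Qed.

Let branch_sig n v b j : sigma_over F (below (rcons v j)) (branch (surv n) v b j).
Proof. by apply: branch_sigma => b'; exact: surv_sigma. Qed.

Let mS n v b : measurable (surv n v b).
Proof. exact: (sigma_meas (@surv_sigma n v b)). Qed.

Let mbranch n v b j : measurable (branch (surv n) v b j).
Proof. exact: (sigma_meas (@branch_sig n v b j)). Qed.

Lemma prob_bin v b : (b < M)%N -> fine (P (U v @^-1` bin b)) = M%:R^-1.
Proof.
move=> bM; rewrite -(uniform_prob_bin R bM); case: NU => _ UU _.
by rewrite -(UU v)//; exact: measurable_itv.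
Qed.

Lemma prob_offspring v k : fine (P (N v @^-1` [set k])) = fine (L [set k]).
Proof. by case: NU => NL _ _; rewrite -(NL v). Qed.

(** The events for different cells of the child are disjoint, and the label of
the child is independent of the survival event, which does not involve it. *)
Lemma prob_branch_ge n v b j :
  \sum_(0 <= b' < M | b.+1%:R <= b'%:R + theta * M%:R)
     fine (P (surv n (rcons v j) b')) / M%:R <= fine (P (branch (surv n) v b j)).
Proof.
have mB b' : measurable (U (rcons v j) @^-1` bin b').
  by apply: measurable_preimageU; exact: measurable_itv.
pose X b' := U (rcons v j) @^-1` bin b' `&` surv n (rcons v j) b'.
apply: (@le_trans _ _ (\sum_(0 <= b' < M | b.+1%:R <= b'%:R + theta * M%:R)
    fine (P (X b')))); last first.
  apply: fine_prob_sum_le.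
  - exact: mbranch.
  - by move=> b'; exact: measurableI.
  - by move=> b' b'' _ _ [w [[wb _] [wb' _]]]; exact: bin_disjoint wb wb'.
  - by move=> b' b'M bb'; exact: (@bigcup_sup _ _ b').
rewrite big_nat_cond [leRHS]big_nat_cond; apply: ler_sum => b' /andP[/andP[_ b'M] _].
rewrite (indep (J := [set inr (rcons v j)]) (K := strictly_below (rcons v j))).
- by rewrite fineM ?fin_num_measure// prob_bin// mulrC.
- by move=> i [/= ->] /=; rewrite eqxx andbF.
- apply: (@sigma_over_gen _ _ _ _ _ (inr (rcons v j))) => //.
  by exists (bin b'); rewrite ?setTI//; exact: measurable_itv.
- exact: surv_sigma.
Qed.

Definition offspring_above v k : set (vertex + vertex) :=
  \bigcup_(j in `I_k) below (rcons v j).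

(** Different children have disjoint subtrees, so their failures multiply.  The
membership in the sigma-algebra is carried along for the induction. *)
Lemma no_branch n v b p k : 0 <= p <= 1 ->
  (forall j, p <= fine (P (branch (surv n) v b j))) ->
  sigma_over F (offspring_above v k) (\bigcap_(j in `I_k) ~` branch (surv n) v b j) /\
  fine (P (\bigcap_(j in `I_k) ~` branch (surv n) v b j)) <= (1 - p) ^+ k.
Proof.
move=> /andP[p0 p1] pb; elim: k => [|k [IHs IH]].
  rewrite II0 bigcap_set0 probability_setT expr0; split => //.
  by rewrite /= -setC0; apply: sigma_algebraC; exact: sigma_algebra0.
rewrite IIS bigcap_setU bigcap_set1.
have sk : sigma_over F (below (rcons v k)) (~` branch (surv n) v b k).
  by apply: sigma_algebraC; exact: branch_sig.
split.
  apply: sigma_over_setI.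
    by apply: sigma_over_sub IHs; apply: bigcup_subset => j /= /ltnW.
  by apply: sigma_over_sub sk => i ki; exists k => /=.
rewrite (indep _ IHs sk); last first.
  by move=> [w|w] [[j /= jk wj] wk]; have := prefix_rcons_inj wj wk => jk';
     rewrite jk' ltnn in jk.
rewrite fineM ?fin_num_measure//; [|exact: sigma_meas IHs|exact: (sigma_meas sk)].
rewrite exprSr; apply: ler_pM => //; [exact: fine_ge0|exact: fine_ge0|].
rewrite fine_probC ?lerD2l ?lerN2//; exact: mbranch.
Qed.

Lemma prob_surv_step n v b p B : 0 <= p <= 1 ->
  (forall j, p <= fine (P (branch (surv n) v b j))) ->
  \sum_(0 <= k < B) fine (L [set k]) * (1 - (1 - p) ^+ k) <=
  fine (P (surv n.+1 v b)).
Proof.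
move=> p01 pb.
pose X k := N v @^-1` [set k] `&` \bigcup_(j in `I_k) branch (surv n) v b j.
have hs k : sigma_over F (offspring_above v k)
    (\bigcup_(j in `I_k) branch (surv n) v b j).
  have [+ _] := no_branch k p01 pb; move=> /sigma_algebraC.
  by rewrite -setC_bigcup setCK.
have mX k : measurable (X k).
  by apply: measurableI; [exact: measurable_preimageN|exact: (sigma_meas (hs k))].
apply: (@le_trans _ _ (\sum_(0 <= k < B) fine (P (X k)))); last first.
  apply: fine_prob_sum_le => //.
  - by move=> k k' _ _ [w [[/= wk _] [/= wk' _]]]; rewrite -wk -wk'.
  - by move=> k _ _; exact: (@bigcup_sup _ _ k).
apply: ler_sum => k _.
rewrite /X (indep (J := [set inl v]) (K := offspring_above v k)) //.
- rewrite fineM ?fin_num_measure//; last 2 first.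
  + exact: measurable_preimageN.
  + exact: (sigma_meas (hs k)).
  rewrite prob_offspring ler_wpM2l ?fine_ge0//.
  have [nb1 nb2] := no_branch k p01 pb.
  rewrite -(setCK (\bigcup_(j in _) _)) fine_probC setC_bigcup.
    by rewrite lerD2l lerN2.
  exact: (sigma_meas nb1).
- by move=> i [/= ->] [j /= _] /=; rewrite prefix_rcons_self.
- apply: (@sigma_over_gen _ _ _ _ _ (inl v)) => //.
  by exists [set k]; rewrite ?setTI.
Qed.

(** The induction on generations.  The number e is chosen so small that the
quadratic loss e kap^2 S2 is covered by the excess kap S1 - 1 of the truncated
mean over the critical value. *)
Lemma prob_surv_ge (v : nat -> R) (kap : R) (B : nat) :
  0 < kap ->
  (forall i, (i < M)%N -> 0 < v i <= 1) ->
  (forall i, (i < M)%N -> kap * v i <=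
     \sum_(0 <= j < M | i.+1%:R <= j%:R + theta * M%:R) v j / M%:R) ->
  1 < kap * (\sum_(0 <= k < B) k%:R * fine (L [set k])) ->
  exists2 e : R, 0 < e & forall n u b, (b < M)%N -> e * v b <= fine (P (surv n u b)).
Proof.
move=> k0 v01 kv kB.
set S1 := \sum_(_ <= _ < _) _ in kB.
pose S2 := \sum_(0 <= k < B) k%:R ^+ 2 * fine (L [set k]).
have S20 : 0 <= S2 by apply: sumr_ge0 => k _; rewrite mulr_ge0 ?sqr_ge0 ?fine_ge0.
have [e [e0 ek e1 eS]] : exists e : R, [/\ 0 < e, e * kap <= 1, e <= 1 &
    e * (kap ^+ 2 * S2) <= kap * S1 - 1].
  exists (Num.min (Num.min 1 kap^-1) ((kap * S1 - 1) / (kap ^+ 2 * S2 + 1))).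
  have d0 : 0 < kap ^+ 2 * S2 + 1 by rewrite ltr_wpDl// mulr_ge0// sqr_ge0.
  split.
  - by rewrite !lt_min ltr01 invr_gt0 k0 divr_gt0//; lra.
  - by rewrite -ler_pdivlMr// div1r !ge_min lexx orbT.
  - by rewrite !ge_min lexx.
  - apply: (@le_trans _ _
        ((kap * S1 - 1) / (kap ^+ 2 * S2 + 1) * (kap ^+ 2 * S2 + 1))); last first.
      by rewrite divfK ?gt_eqF.
    apply: ler_pM.
    + by rewrite ltW// !lt_min ltr01 invr_gt0 k0 divr_gt0//; lra.
    + by rewrite mulr_ge0 ?sqr_ge0.
    + by rewrite ge_min lexx orbT.
    + by rewrite lerDl.
exists e => //; elim=> [|n IH] u b bM.
  rewrite probability_setT /=; have /andP[v0 v1] := v01 b bM; nra.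
have /andP[v0 v1] := v01 b bM.
pose p := e * (kap * v b).
have p01 : 0 <= p <= 1.
  rewrite /p; apply/andP; split; first by rewrite !mulr_ge0 ?ltW.
  rewrite mulrA (le_trans _ ek)// ler_piMr// mulr_ge0 ?ltW//.
have pb j : p <= fine (P (branch (surv n) u b j)).
  apply: le_trans (prob_branch_ge n u b j).
  rewrite /p (le_trans (ler_wpM2l (ltW e0) (kv b bM)))// big_distrr/=.
  rewrite big_nat_cond [leRHS]big_nat_cond; apply: ler_sum => b' /andP[/andP[_ b'M] _].
  by rewrite mulrA ler_wpM2r ?invr_ge0// IH.
apply: le_trans (prob_surv_step B p01 pb).
apply: (@le_trans _ _ (p * S1 - p ^+ 2 * S2)).
  have : p * kap <= e * kap ^+ 2.
    by rewrite /p expr2 -!mulrA ler_pM2l// ler_pM2l// ler_piMl// ltW.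
  move=> pk; have : p * kap * S2 <= kap * S1 - 1.
    by rewrite (le_trans _ eS)// mulrA ler_wpM2r.
  move=> H; have H2 : 0 <= e * v b by rewrite mulr_ge0 ?ltW.
  have := ler_wpM2l H2 H; rewrite /p; nra.
rewrite /S1 /S2 !big_distrr -sumrB; apply: ler_sum => k _ /=.
have -> : p * (k%:R * fine (L [set k])) - p ^+ 2 * (k%:R ^+ 2 * fine (L [set k])) =
  fine (L [set k]) * (k%:R * p - k%:R ^+ 2 * p ^+ 2) by ring.
by rewrite ler_wpM2l ?fine_ge0 ?one_minus_expn_ge.
Qed.

Lemma increasing_path_prob_gt0 (m : R) (v : nat -> R) (kap : R) :
  0 <= m -> 1 < kap * m -> 'E_L[fun k : nat => k%:R]%E = m%:E ->
  (forall i, (i < M)%N -> 0 < v i <= 1) ->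
  (forall i, (i < M)%N -> kap * v i <=
     \sum_(0 <= j < M | i.+1%:R <= j%:R + theta * M%:R) v j / M%:R) ->
  (0 < P (increasing_path_event theta N U))%E.
Proof.
move=> m0 km Em v01 kv.
have k0 : 0 < kap by nra.
have [B] : exists B : nat, kap^-1 < \sum_(0 <= k < B) k%:R * fine (L [set k]).
  by apply: expectation_partial_sum Em _; rewrite -div1r ltr_pdivrMr// mulrC.
rewrite -div1r ltr_pdivrMr// mulrC => kB.
have [e e0 eP] := prob_surv_ge k0 v01 kv kB.
apply: (@lt_le_trans _ _ (e * v 0%N / M%:R)%:E).
  by rewrite lte_fin divr_gt0 ?ltr0n// mulr_gt0//; have /andP[] := v01 0%N M_gt0.
apply: increasing_path_prob_ge => n.
have mB b' : measurable (U [::] @^-1` bin b').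
  by apply: measurable_preimageU; exact: measurable_itv.
rewrite -(fineK (fin_num_measure P _ (measurable_reach_event _ _ _ _ _))) lee_fin.
apply: le_trans (fine_prob_le P _ _ (@surv_reach n [::] 0%N)); last 2 first.
- exact: measurableI.
- exact: measurable_reach_event.
rewrite (indep (J := [set inr [::]]) (K := strictly_below [::])).
- rewrite fineM ?fin_num_measure// prob_bin// mulrC ler_wpM2l ?invr_ge0//.
  exact: eP.
- by move=> i [/= ->].
- apply: (@sigma_over_gen _ _ _ _ _ (inr [::])) => //.
  by exists (bin 0%N); rewrite ?setTI//; exact: measurable_itv.
- exact: surv_sigma.
Qed.

End survival.

(** * The delayed exponential and the critical value *)

Section delayed_exponential.
Variable R : realType.
Implicit Types a b c s t x y theta : R.

(** The exponent 1 has a kink at a, and to the left of a the right-hand side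
would read 0 ^+ 0 = 1; the exponents from 2 on are of class C^1. *)
Lemma is_derive_pos_pow (i : nat) a s : a < s \/ (0 < i)%N ->
  is_derive s 1 (fun u : R => Num.max (u - a) 0 ^+ i.+1 : R)
    (i.+1%:R * Num.max (s - a) 0 ^+ i).
Proof.
have [sa|sa|->] := ltrgtP s a => H.
- apply: (@near_eq_is_derive _ _ _ (cst 0)).
    near=> u; have ua : u < a by near: u; exact: lt_nbhsl.
    by rewrite (_ : Num.max _ _ = 0) ?expr0n//; apply/max_idPr; lra.
  rewrite (_ : _ * _ = 0); first exact: is_derive_cst.
  rewrite (_ : Num.max _ _ = 0); last by apply/max_idPr; lra.
  by case: H => [//|i0]; rewrite expr0n gtn_eqF// mulr0.
- apply: (@near_eq_is_derive _ _ _ ((id - cst a) ^+ i.+1)).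
    near=> u; have ua : a < u by near: u; exact: lt_nbhsr.
    rewrite (_ : Num.max _ _ = u - a); last by apply/max_idPl; lra.
    by rewrite fctE.
  rewrite (_ : Num.max _ _ = s - a); last by apply/max_idPl; lra.
  apply: is_derive_eq.
  by rewrite subr0 /GRing.scale /= mulr1.
- case: H => //
  ; case: i => // i _.
  have quot_le (e h : R) : h != 0 -> `|h| <= Num.min 1 e ->
      `|h^-1 * Num.max h 0 ^+ i.+2| <= e.
    rewrite le_min => h0 /andP[h1 he]; have e0 := le_trans (normr_ge0 _) he.
    have [hn|hp] := leP h 0; first by rewrite expr0n mulr0 normr0.
    rewrite exprS mulKf// normrX exprS (le_trans _ he)//.
    by rewrite ler_piMr// exprn_ile1.
  have H : h^-1 *: ((fun u : R => Num.max (u - a) 0 ^+ i.+2) (h *: 1 + a) -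
      Num.max (a - a) 0 ^+ i.+2) @[h --> (0:R)^'] --> (0:R).
    apply/cvgrPdist_le => e e0; near=> h.
    rewrite addrK subrr maxxx expr0n subr0 sub0r normrN /GRing.scale /= mulr1.
    apply: quot_le; near: h; first exact: nbhs_dnbhs_neq.
    by apply: dnbhs0_le; rewrite lt_min ltr01.
  apply: DeriveDef; first by apply/cvg_ex; exists 0.
  by rewrite subrr maxxx expr0n mulr0; apply: cvg_lim.
Unshelve. all: by end_near.
Qed.

(** The solution of e = 1 on [0, theta] and e'(t) = - x e(t - theta), obtained by
integrating over successive intervals of length theta.  The term j = 0 is the
constant 1, since 0 ^+ 0 = 1. *)
Definition dexp theta (n : nat) x t : R :=
  \sum_(0 <= j < n) (- x) ^+ j / j`!%:R * Num.max (t - j%:R * theta) 0 ^+ j.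

(** The summation range of Q_theta; on [0, 1 + theta] later terms vanish. *)
Definition nterms theta := (Num.truncn theta^-1).+2.

Lemma dexp_end theta x : 0 < theta ->
  dexp theta (nterms theta) x (1 + theta) = Q_theta theta x.
Proof.
move=> th0; rewrite /dexp /Q_theta; apply: eq_big_nat => j /andP[_ jn].
congr (_ * _ ^+ _); have -> : 1 + theta - j%:R * theta = 1 - (j%:R - 1) * theta by ring.
apply/max_idPl; rewrite subr_ge0 -ler_pdivlMr// div1r.
case: j jn => [|j] jn; first by rewrite sub0r (@le_trans _ _ 0) ?invr_ge0 ?ltW ?oppr_lt0.
rewrite -natr1 addrK; apply: (@le_trans _ _ (Num.truncn theta^-1)%:R).
  by rewrite ler_nat -ltnS.
by rewrite truncn_le invr_ge0 ltW.
Qed.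

Lemma dexp_le_theta theta n x t : 0 < theta -> t <= theta -> dexp theta n.+1 x t = 1.
Proof.
move=> th0 tth; rewrite /dexp big_nat_recl// expr0 expr0 fact0 divr1 mul1r.
rewrite big1 ?addr0// => j _.
rewrite (_ : Num.max _ _ = 0) ?expr0n ?mulr0//; apply/max_idPr.
rewrite -natr1; have : 0 <= (j%:R : R) by []. by nra.
Qed.

(** Differentiation lowers each exponent by one; the last term of the sum at t
has no counterpart, but it vanishes because the truncation point exceeds 1. *)
Lemma is_derive_dexp theta x t : 0 < theta -> 0 < t <= 1 ->
  is_derive t 1 (fun u : R => dexp theta (nterms theta) x (u + theta) : R)
    (- x * dexp theta (nterms theta) x t).
Proof.
move=> th0 /andP[t0 t1]; rewrite /nterms; set p := (Num.truncn _).+1.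
have -> : (fun u => dexp theta p.+1 x (u + theta)) =
  cst 1 + \sum_(i < p) (((- x) ^+ i.+1 / i.+1`!%:R) \*:
     (fun u : R => Num.max (u - i%:R * theta) 0 ^+ i.+1 : R)).
  apply/funext => u; rewrite /dexp big_nat_recl// expr0 expr0 fact0 divr1 mul1r.
  rewrite big_mkord fctE fct_sumE /=; congr (_ + _); apply: eq_bigr => i _ /=.
  congr (_ * _ ^+ _); congr (Num.max _ _); rewrite -natr1; ring.
have ptheta : 1 < p%:R * theta.
  by rewrite -ltr_pdivrMr// div1r truncnS_gt.
have -> : - x * dexp theta p.+1 x t = 0 +
    \sum_(i < p) ((- x) ^+ i.+1 / i.+1`!%:R) *:
      (i.+1%:R * Num.max (t - i%:R * theta) 0 ^+ i).
  rewrite add0r /dexp big_nat_recr//= (_ : Num.max (t - p%:R * theta) 0 = 0); last first.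
    by apply/max_idPr; lra.
  rewrite expr0n mulr0 addr0 big_mkord big_distrr; apply: eq_bigr => i _ /=.
  rewrite factS natrM exprS.
  have : i`!%:R != 0 :> R by rewrite pnatr_eq0 -lt0n fact_gt0.
  have : i.+1%:R != 0 :> R by rewrite pnatr_eq0.
  move=> *; rewrite /GRing.scale /=; field.
  by apply/andP.
apply: is_deriveD; apply: is_derive_sum => i; apply: is_deriveZ.
apply: is_derive_pos_pow; case: (posnP i) => [->|]; last by right.
by left; rewrite mul0r.
Qed.


Lemma continuous_dexp_shift theta n x :
  continuous (fun u : R => dexp theta n x (u + theta) : R).
Proof.
elim: n => [|n IH] u.
  by rewrite (_ : (fun _ => _) = cst 0); [exact: cvg_cst|
    apply/funext => v; rewrite /dexp big_geq].
rewrite /continuous_at /dexp big_nat_recr//=.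
under eq_fun do rewrite big_nat_recr//=.
apply: cvgD; first exact: IH.
apply: cvgM; first exact: cvg_cst.
apply: (@continuous_comp _ _ _ (fun v : R => Num.max (v + theta - n%:R * theta) 0)
  (fun v : R => v ^+ n)); last exact: exprn_continuous.
apply: (@continuous_max _ _ (fun v : R => v + theta - n%:R * theta) (cst 0)).
  by apply: cvgB; [apply: cvgD; [exact: cvg_id|exact: cvg_cst]|exact: cvg_cst].
exact: cvg_cst.
Qed.

(** x times the integral over [a, b] is the decrease of the function one delay
later, and the integral is at least c (b - a).  The case
c = 0 gives monotonicity, the case c = dexp at b a lower Riemann sum. *)
Lemma dexp_drop theta x c a b : 0 < theta -> 0 <= x ->
  0 <= a -> a <= b -> b <= 1 ->
  (forall t, a < t < b -> c <= dexp theta (nterms theta) x t) ->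
  x * (b - a) * c <= dexp theta (nterms theta) x (a + theta) -
                     dexp theta (nterms theta) x (b + theta).
Proof.
move=> th0 x0 a0 ab b1 ce.
set E := dexp _ _ _ in ce *.
pose H : R -> R := (fun u => E (u + theta)) + (x * c) \*: id.
have dH t : a < t < b -> is_derive t 1 H (- x * E t + (x * c) *: 1).
  move=> /andP[at_ tb]; apply: is_deriveD; apply: is_derive_dexp => //.
  by rewrite (le_lt_trans a0)// (le_trans (ltW tb)).
suff : H b <= H a.
  rewrite (_ : H b = E (b + theta) + x * c * b)// (_ : H a = E (a + theta) + x * c * a)//.
  by lra.
apply: (@ler0_derive1_le_cc _ H a b) => //.
- by move=> t; rewrite in_itv/= => /dH [].
- move=> t; rewrite in_itv/= => tab; have [_] := dH _ tab.
  rewrite derive1E => ->; rewrite /GRing.scale /= mulr1 mulNr.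
  by rewrite addrC subr_le0 ler_wpM2l// ce.
- apply: continuous_subspaceT => t; apply: cvgD; first exact: continuous_dexp_shift.
  by apply: cvgZl_tmp; exact: cvg_id.
- by rewrite in_itv/= ab lexx.
- by rewrite in_itv/= lexx ab.
Qed.

Lemma dexp_noninc theta x s t : 0 < theta -> 0 <= x ->
  (forall t, t <= 1 -> 0 <= dexp theta (nterms theta) x t) ->
  s <= t -> t <= 1 + theta ->
  dexp theta (nterms theta) x t <= dexp theta (nterms theta) x s.
Proof.
move=> th0 x0 E0 st t1; set E := dexp _ _ _ in E0 *.
have [tth|tth] := leP t theta; first by rewrite /E !dexp_le_theta// (le_trans st).
have [s' [s'0 s't ->]] : exists s', [/\ 0 <= s', s' <= t - theta & E s = E (s' + theta)].
  have [sth|sth] := leP s theta.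
    exists 0; split=> //; first by rewrite subr_ge0 ltW.
    by rewrite /E !dexp_le_theta ?add0r.
  by exists (s - theta); rewrite subrK; split=> //; lra.
have := @dexp_drop theta x 0 s' (t - theta) th0 x0 s'0 s't.
rewrite mulr0 subrK subr_ge0; apply; first by lra.
by move=> u /andP[_ ut]; apply: E0; lra.
Qed.

Lemma expr_lipschitz (n : nat) B : 0 <= B -> exists2 C, 0 <= C &
  forall x y, 0 <= x <= B -> 0 <= y <= B -> `|x ^+ n - y ^+ n| <= C * `|x - y|.
Proof.
move=> B0; elim: n => [|n [C C0 IH]].
  by exists 0 => // x y _ _; rewrite subrr normr0 mul0r.
exists (B * C + B ^+ n) => [|x y xB yB].
  by rewrite addr_ge0 ?mulr_ge0 ?exprn_ge0.
have -> : x ^+ n.+1 - y ^+ n.+1 = x * (x ^+ n - y ^+ n) + (x - y) * y ^+ n.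
  by rewrite !exprS; ring.
apply: (le_trans (ler_normD _ _)); rewrite [leRHS]mulrDl; apply: lerD; rewrite !normrM.
  case/andP: (xB) => x0 x1; rewrite (ger0_norm x0) -mulrA.
  by apply: ler_pM => //; exact: IH.
case/andP: yB => y0 y1.
by rewrite mulrC ler_wpM2r// ger0_norm ?exprn_ge0// lerXn2r.
Qed.

Lemma dexp_lipschitz theta n B : 0 < theta -> 0 <= B -> exists2 C, 0 <= C &
  forall x y t, 0 <= x <= B -> 0 <= y <= B -> t <= 1 + theta ->
    `|dexp theta n x t - dexp theta n y t| <= C * `|x - y|.
Proof.
move=> th0 B0; elim: n => [|n [C C0 IH]].
  by exists 0 => // x y t _ _ _; rewrite /dexp !big_geq// subrr normr0 mul0r.
have [D D0 HD] := expr_lipschitz n B0.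
exists (C + D * (1 + theta) ^+ n) => [|x y t xB yB t1].
  by rewrite addr_ge0// mulr_ge0// exprn_ge0//; lra.
have -> : dexp theta n.+1 x t - dexp theta n.+1 y t =
    (dexp theta n x t - dexp theta n y t) +
    (x ^+ n - y ^+ n) * ((-1) ^+ n / n`!%:R * Num.max (t - n%:R * theta) 0 ^+ n).
  rewrite /dexp !big_nat_recr//= (exprNn x) (exprNn y); ring.
apply: (le_trans (ler_normD _ _)); rewrite [leRHS]mulrDl; apply: lerD; first exact: IH.
rewrite [leRHS]mulrAC normrM; apply: ler_pM => //; first exact: HD.
rewrite !normrM normrX normrN1 expr1n mul1r normfV normrX.
rewrite !ger0_norm//; last by rewrite le_max lexx orbT.
rewrite (@le_trans _ _ (1 * Num.max (t - n%:R * theta) 0 ^+ n))//.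
  rewrite ler_wpM2r// ?exprn_ge0 ?le_max ?lexx ?orbT//.
  by rewrite invf_le1 ?ler1n ?ltr0n fact_gt0.
rewrite mul1r lerXn2r// ?nnegrE ?le_max ?lexx ?orbT//; first by lra.
rewrite ge_max; apply/andP; split; last by lra.
have : 0 <= (n%:R : R) by []. by nra.
Qed.

(** Deformation in the parameter.  If e_y >= 0 then e_y is nonincreasing, hence
bounded below by its end value Q_theta(y), which is positive as long as no root
has been met; the Lipschitz bound in y then keeps e nonnegative a little
further.  So the parameters y with e_y >= 0 exhaust [0, B]. *)
Lemma dexp_ge0 theta B t : 0 < theta -> 0 <= B ->
  (forall y, 0 <= y <= B -> Q_theta theta y != 0) -> t <= 1 + theta ->
  0 <= dexp theta (nterms theta) B t.
Proof.
move=> th0 B0 Qn0; move: t.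
have [C C0 HC] := dexp_lipschitz (nterms theta) th0 B0.
have CS y z t : 0 <= y <= B -> 0 <= z <= B -> t <= 1 + theta ->
  dexp theta (nterms theta) y t - (C + 1) * `|y - z| <= dexp theta (nterms theta) z t.
  move=> yB zB t1; have := ler_normlW (HC y z t yB zB t1).
  have : 0 <= `|y - z| by []. by nra.
pose A := [set y | 0 <= y <= B /\
  forall t, t <= 1 + theta -> 0 <= dexp theta (nterms theta) y t].
have A0 : A 0.
  split; first by rewrite lexx.
  move=> t _; rewrite /dexp big_nat_recl// big1 ?addr0.
    by rewrite !expr0 fact0 divr1 mulr1.
  by move=> j _; rewrite oppr0 expr0n !mul0r.
have ubA : ubound A B by move=> y [/andP[]].
have supA : has_sup A by split; [exists 0|exists B].
have s0 : 0 <= sup A by apply: ub_le_sup => //; exists B.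
have sB : sup A <= B by apply: ge_sup => //; exists 0.
have sIB : 0 <= sup A <= B by rewrite s0.
have As t : t <= 1 + theta -> 0 <= dexp theta (nterms theta) (sup A) t.
  move=> t1; rewrite leNgt; apply/negP => neg.
  have d0 : 0 < - dexp theta (nterms theta) (sup A) t / (C + 1).
    by rewrite divr_gt0 ?oppr_gt0//; lra.
  have [y Ay ys] := sup_adherent d0 supA.
  have yle : y <= sup A by apply: ub_le_sup => //; exists B.
  have := CS y (sup A) t Ay.1 sIB t1; have := Ay.2 t t1.
  rewrite ler0_norm ?subr_le0//.
  have : (C + 1) * (sup A - y) < - dexp theta (nterms theta) (sup A) t.
    by rewrite mulrC -ltr_pdivlMr; lra.
  by lra.
move: sB; rewrite le_eqVlt => /predU1P[<-//|sB].
have Qs : 0 < Q_theta theta (sup A).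
  by rewrite lt_neqAle eq_sym Qn0//= -dexp_end// As.
have Em t : t <= 1 + theta ->
    Q_theta theta (sup A) <= dexp theta (nterms theta) (sup A) t.
  move=> t1; rewrite -dexp_end//; apply: dexp_noninc => // u u1.
  by apply: As; lra.
set y := Num.min B (sup A + Q_theta theta (sup A) / (C + 1)).
have d0 : 0 < Q_theta theta (sup A) / (C + 1) by rewrite divr_gt0//; lra.
have ys : sup A < y by rewrite lt_min sB ltrDl.
have yB : 0 <= y <= B.
  by rewrite (le_trans s0 (ltW ys))/= ge_min lexx.
have Ay : A y.
  split=> // t t1; apply: le_trans (CS _ _ _ sIB yB t1).
  rewrite subr_ge0 (le_trans _ (Em _ t1))// distrC gtr0_norm ?subr_gt0//.
  rewrite mulrC -ler_pdivlMr; last by lra.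
  by rewrite lerBlDl ge_min lexx orbT.
have : y <= sup A by apply: ub_le_sup => //; exists B.
by rewrite leNgt ys.
Qed.

(** If m (1 - (1 - theta)^2) > 1, there is x < m with k x > 1.  Then g = e_x is
positive with x K g <= g, while k v <= K v; where the quotient of v by g is
maximal, with value C, this gives k C g <= C g / x, a contradiction.  The
quotient is taken at the right end w i of cell i, so that the sums are lower
Riemann sums for g. *)
Lemma critical_theta_le m theta : 1 <= m -> is_theta_c m theta ->
  theta <= 1 - Num.sqrt (1 - m^-1).
Proof.
move=> m1 [/andP[th0 th1] [_ mmin]]; rewrite leNgt; apply/negP => ath.
have th01 : 0 <= theta <= 1 by rewrite ltW.
have [M [v [k [M0 km v01 kv]]]] := discrete_subsolution m1 th01 ath.
have MR0 : 0 < M%:R :> R by rewrite ltr0n.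
have k0 : 0 < k by nra.
pose x := (m + k^-1) / 2.
have km' : k^-1 < m by rewrite -div1r ltr_pdivrMr// mulrC.
have xm : x < m by rewrite /x; lra.
have kx : k^-1 < x by rewrite /x; lra.
have x0 : 0 < x by rewrite (lt_trans _ kx)// invr_gt0.
pose E := dexp theta (nterms theta) x.
have Qn0 y : 0 <= y <= x -> Q_theta theta y != 0.
  move=> /andP[_ yx]; apply/negP => /eqP/mmin; lra.
have E0 t : t <= 1 + theta -> 0 <= E t by apply: dexp_ge0 => //; exact: ltW.
have Eni s t : s <= t -> t <= 1 + theta -> E t <= E s.
  by apply: dexp_noninc => // [|u u1]; [exact: ltW|apply: E0; lra].
have Eend : 0 < E (1 + theta).
  rewrite lt_neqAle E0// andbT eq_sym /E dexp_end// Qn0// ltW//=.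
have Egt0 t : t <= 1 + theta -> 0 < E t.
  by move=> t1; rewrite (lt_le_trans Eend)// Eni.
pose w (i : nat) : R := i.+1%:R / M%:R.
have w1 i : (i < M)%N -> w i <= 1.
  by move=> iM; rewrite ler_pdivrMr// mul1r ler_nat.
have Ew i : (i < M)%N -> 0 < E (w i).
  by move=> iM; apply: Egt0; have := w1 _ iM; lra.
(* x K g <= g at w i, in the form of lower Riemann sums. *)
have step i : (i < M)%N ->
    x * (\sum_(0 <= j < M | i.+1%:R <= j%:R + theta * M%:R) E (w j) / M%:R) <=
    E (w i).
  move=> iM.
  suff H n : (n <= M)%N ->
     x * (\sum_(0 <= j < n | i.+1%:R <= j%:R + theta * M%:R) E (w j) / M%:R) <=
     Num.max 0 (E (w i) - E (n%:R / M%:R + theta)).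
    apply: le_trans (H M (leqnn M)) _.
    rewrite divff ?gt_eqF// ge_max ltW ?Ew//=; have := Eend; lra.
  elim: n => [|n IH] nM; first by rewrite big_nil mulr0 le_max lexx.
  have {}IH := IH (ltnW nM).
  rewrite big_mkcond big_nat_recr//= -big_mkcond/= mulrDr.
  have wn : w i <= n%:R / M%:R + theta = (i.+1%:R <= n%:R + theta * M%:R).
    by rewrite /w ler_pdivrMr// mulrDl divfK// gt_eqF.
  have nM1 : n.+1%:R / M%:R <= 1 :> R by exact: w1.
  rewrite -wn; have [win|win] := leP (w i) (n%:R / M%:R + theta).
    have drop : x * M%:R^-1 * E (w n) <=
        E (n%:R / M%:R + theta) - E (n.+1%:R / M%:R + theta).
      have := @dexp_drop theta x (E (w n)) (n%:R / M%:R) (n.+1%:R / M%:R) th0 (ltW x0).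
      rewrite -mulrBl -natrB// subSnn div1r => H.
      apply: H => //.
      - by rewrite ler_pM2r ?invr_gt0// ler_nat.
      - by move=> t /andP[_ tw]; apply: Eni; [exact: ltW|rewrite /w; lra].
    have IH' : E (n%:R / M%:R + theta) <= E (w i).
      apply: Eni => //.
      rewrite lerD2r (le_trans _ nM1)//.
      by rewrite ler_pM2r ?invr_gt0// ler_nat.
    rewrite (max_idPr _) in IH; last by lra.
    by rewrite le_max; apply/orP; right; lra.
  rewrite mulr0 addr0 (le_trans IH)// ge_max le_max lexx/= le_max.
  apply/orP; left; rewrite subr_le0; apply: Eni; first exact: ltW.
  by have := w1 _ iM; lra.
pose i0 : 'I_M := Ordinal M0.
have [i _ imax] := @Order.TotalTheory.arg_maxP _ _ _ i0 xpredT
  (fun i : 'I_M => v i / E (w i)) isT.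
set C := v i / E (w i) in imax.
have C0 : 0 < C by rewrite divr_gt0 ?Ew//; have /andP[] := v01 i (ltn_ord i).
have vC j : (j < M)%N -> v j <= C * E (w j).
  by move=> jM; rewrite -ler_pdivrMr ?Ew//; exact: (imax (Ordinal jM) isT).
have : k * v i <= C * (\sum_(0 <= j < M | i.+1%:R <= j%:R + theta * M%:R) E (w j) / M%:R).
  apply: (le_trans (kv i (ltn_ord i))); rewrite big_distrr/=.
  rewrite big_nat_cond [leRHS]big_nat_cond; apply: ler_sum => j /andP[/andP[_ jM] _].
  by rewrite mulrA ler_wpM2r ?invr_ge0// vC.
have := step i (ltn_ord i); set S := \sum_(_ <= _ < _ | _) _ => xS kvS.
have vE : v i = C * E (w i) by rewrite divfK// gt_eqF// Ew.
have Ei := Ew i (ltn_ord i).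
have : k * E (w i) <= S.
  by rewrite -(ler_pM2l C0) mulrCA -vE.
have : E (w i) < x * (k * E (w i)).
  by rewrite mulrA -ltr_pdivrMr// divff ?gt_eqF// -ltr_pdivrMr// div1r.
by rewrite ltNge => /negP h kE; apply: h; rewrite (le_trans _ xS)// ler_pM2l.
Qed.

End delayed_exponential.

(** * Asymptotics of the threshold *)

(** With y = 1/m and s = sqrt(1 - y), the difference 1 - s - y/2 equals
(1 - s)^2 / 2, and 1 - s <= y. *)
Lemma equiv_threshold (R : realType) :
  (fun m : R => (1 - Num.sqrt (1 - m^-1))%R : R^o) ~_(+oo_R)
    (fun m : R => ((2 * m)^-1)%R : R^o).
Proof.
apply/eqaddoP => _/posnumP[e].
near=> m.
have m1 : 1 < m by near: m; apply: nbhs_pinfty_gt; rewrite num_real.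
have me : e%:num^-1 < m by near: m; apply: nbhs_pinfty_gt; rewrite num_real.
have m0 : 0 < m by lra.
have y0 : 0 < m^-1 by rewrite invr_gt0.
have y1 : m^-1 < 1 by rewrite invf_lt1.
have ye : m^-1 < e%:num by rewrite invf_plt// posrE.
change (`|(1 - Num.sqrt (1 - m^-1)) - (2 * m)^-1| <= e%:num * `|(2 * m)^-1|).
rewrite invfM; set y := m^-1 in y0 y1 ye *.
have sE : Num.sqrt (1 - y) ^+ 2 = 1 - y by rewrite sqr_sqrtr; lra.
have s0 := sqrtr_ge0 (1 - y); set s := Num.sqrt _ in sE s0 *.
rewrite (@ger0_norm _ (2^-1 * y)); last by lra.
have s1 : s <= 1 by nra.
have -> : 1 - s - 2^-1 * y = 2^-1 * (1 - s) ^+ 2 by nra.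
rewrite ger0_norm; last by rewrite mulr_ge0// ?sqr_ge0; lra.
have : 1 - s <= y by nra.
by nra.
Unshelve. all: by end_near.
Qed.

(** * The theorem *)

Theorem proposition1p9 (R : realType) :
  (forall (d : measure_display) (Omega : measurableType d)
     (P : probability Omega R) (L : probability nat R)
     (N : vertex -> {RV P >-> nat}) (U : vertex -> {RV P >-> R})
     (m theta : R),
     bgw_uniform_labels L N U ->
     1 <= m ->
     'E_L[fun k : nat => k%:R]%E = m%:E ->
     ('E_L[fun k : nat => (k%:R * log_plus k%:R)%R] < +oo)%E ->
     0 <= theta <= 1 ->
     1 - Num.sqrt (1 - m^-1) < theta ->
     measurable (increasing_path_event theta N U) /\
     (0 < P (increasing_path_event theta N U))%E)
  /\
  (forall m theta : R, 1 <= m -> is_theta_c m theta ->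
     theta <= 1 - Num.sqrt (1 - m^-1))
  /\
  (fun m : R => (1 - Num.sqrt (1 - m^-1))%R : R^o) ~_(+oo_R)
    (fun m : R => ((2 * m)^-1)%R : R^o).
Proof.
split; [|split].
- move=> d Omega P L N U m theta NU m1 Em _ th01 ath.
  split; first exact: measurable_increasing_path.
  have [M [v [k [M0 km v01 kv]]]] := discrete_subsolution m1 th01 ath.
  by apply: (increasing_path_prob_gt0 NU M0 _ km Em v01 kv); lra.
- exact: critical_theta_le.
- exact: equiv_threshold.
Qed.
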